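(* Let $n,k,s$ be positive integers with $2\le s\le\lfloor n/k\rfloor$, let $d=\lfloor n/s\rfloor$ (so $d\ge k$), and let $M>0$. For $i\in[0:\lfloor k/2\rfloor]$ define $$f(i)=\begin{cases}\dfrac{Md}{(2k-i-1)i+k(d-k+1)} & 0\le i<\lfloor k/2\rfloor,\\[2mm] \dfrac{Md}{kd-\lfloor k/2\rfloor\lceil k/2\rceil} & i=\lfloor k/2\rfloor.\end{cases}$$ For a repair bandwidth $\gamma=d\beta$ with $\gamma\ge f(\lfloor k/2\rfloor)$, let $\alpha^*(\gamma)$ be the smallest storage $\alpha$ such that, in every information flow graph of the FCRS with parameters $(n,k,s)$, storage $\alpha$ and per-helper download $\beta=\gamma/d$, every data collector has min-cut (to the source) at least $M$. Then $$\alpha^*(\gamma)=\begin{cases}\dfrac{M}{k} & \text{if } \gamma\in[f(0),\infty),\\[2mm] \dfrac{M-\frac{i}{d}(d-k+i)\gamma}{k-i} & \text{if } \gamma\in[f(i),f(i-1)) \text{ for some } i\in[1:\lfloor k/2\rfloor].\end{cases}$$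
   Context: Notation: $[a]=\{1,\dots,a\}$, $[a:b]=\{a,a+1,\dots,b\}$. Fixed Cluster Repair System (FCRS) with parameters $(n,k,s)$: $n=ds+s_0$ servers with $d=\lfloor n/s\rfloor$, $s_0=n \bmod s$, partitioned into clusters $1,\dots,s$ of size $d$ and a cluster $s+1$ of size $s_0$; server $j$ of cluster $i$ is indexed $(i,j)$. A file of size $M$ is stored; each server stores at most $\alpha$ units. Time is slotted; at the end of each time slot exactly one server $(r,\ell)$ fails and is replaced by a newcomer, which chooses an arbitrary repair cluster $i\in[s]$ with $i\neq r$ (cluster $s+1$ never serves as a repair group) and downloads $\beta$ units from each of the $d$ servers of cluster $i$; the repair bandwidth is $\gamma=d\beta$. Under functional repair, any $k$ servers (from any clusters) must be able to recover the file at all times. Information flow graph: a source node; for every server $(i,j)$ and time $t\ge0$ an in-node and an out-node joined by an edge of capacity $\alpha$; at $t=0$ the source connects to every in-node with infinite capacity. If server $(r,\ell)$ fails at the end of slot $t-1$ and is repaired by cluster $i$, there are edges of capacity $\beta$ from the out-nodes at time $t-1$ of all $d$ servers of cluster $i$ to the in-node of $(r,\ell)$ at time $t$; every other server has an infinite-capacity edge from its out-node at time $t-1$ to its in-node at time $t$. A data collector at time $t$ is a node connected by infinite-capacity edges from the time-$t$ out-nodes of some $k$ distinct servers. The graph depends on the (arbitrary, finite) sequence of failures and choices of repair clusters. (The min-cut condition is the feasibility criterion for functional repair, achievable e.g. by random linear network codes.) *)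

(* Defs.v *)
From mathcomp Require Import all_boot all_order all_algebra.
Set Implicit Arguments. Unset Strict Implicit. Unset Printing Implicit Defensive.
Import Order.TTheory GRing.Theory Num.Theory.
Local Open Scope ring_scope.

Inductive cap (R : Type) := CFin of R | CInf.
Arguments CInf {R}.

(* Nodes of the information flow graph for a failure sequence of length T
   and n servers (servers are indexed 0..n-1):
   None                      = the source,
   Some None                 = the data collector,
   Some (Some (t, v, false)) = in-node of server v at time t,
   Some (Some (t, v, true))  = out-node of server v at time t. *)
Definition node (T n : nat) := option (option ('I_T.+1 * 'I_n * bool)).

(* Cluster of a server (0-indexed: clusters 0..s-1 of size d = n/s, and
   cluster s, the remainder cluster of size s0 = n mod s). *)
Definition cluster (n s : nat) (v : 'I_n) : nat :=
  let d := (n %/ s)%N in if (v < d * s)%N then (v %/ d)%N else s.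

(* A failure sequence: the j-th entry (r, i) means that at the end of slot j
   server r fails and is repaired from cluster i (i in 0..s-1), i <> cluster r. *)
Definition valid_failures (n s : nat) (fs : seq ('I_n * 'I_s)) : bool :=
  all (fun p => cluster s p.1 != nat_of_ord p.2) fs.

Definition ifg_edge (R : Type) (n s : nat) (fs : seq ('I_n * 'I_s))
  (tc : 'I_(size fs).+1) (K : {set 'I_n}) (alpha beta : R)
  (x y : node (size fs) n) : option (cap R) :=
  match x, y with
  | None, Some (Some (t, _, false)) =>
      if nat_of_ord t == 0%N then Some CInf else None
  | Some (Some (t, v, false)), Some (Some (t', v', true)) =>
      if (t == t') && (v == v') then Some (CFin alpha) else None
  | Some (Some (t, u, true)), Some (Some (t', v, false)) =>
      if nat_of_ord t' == (nat_of_ord t).+1 then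
        match onth fs t with
        | Some (r, i) =>
            if v == r then
              (if cluster s u == nat_of_ord i then Some (CFin beta) else None)
            else if u == v then Some CInf else None
        | None => None
        end
      else None
  | Some (Some (t, v, true)), Some None =>
      if (t == tc) && (v \in K) then Some CInf else None
  | _, _ => None
  end.

Definition is_inf (R : Type) (c : option (cap R)) : bool :=
  if c is Some CInf then true else false.

Definition fincap (R : numDomainType) (c : option (cap R)) : R :=
  if c is Some (CFin a) then a else 0.

(* Capacity of the cut (U, ~: U); it is infinite iff some infinite edge
   crosses it, otherwise it is the finite sum below. *)
Definition cut_has_inf (R : Type) (V : finType) (E : V -> V -> option (cap R))
  (U : {set V}) : bool :=
  [exists x in U, exists y in ~: U, is_inf (E x y)].

Definition cut_value (R : numDomainType) (V : finType)
  (E : V -> V -> option (cap R)) (U : {set V}) : R :=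
  \sum_(x in U) \sum_(y in ~: U) fincap (E x y).

Definition mincut_ge (R : numDomainType) (V : finType)
  (E : V -> V -> option (cap R)) (src snk : V) (M : R) : Prop :=
  forall U : {set V}, src \in U -> snk \notin U ->
    ~~ cut_has_inf E U -> M <= cut_value E U.

Definition fcrs_feasible (R : numDomainType) (n k s : nat) (M alpha beta : R)
  : Prop :=
  forall fs : seq ('I_n * 'I_s), valid_failures fs ->
  forall (tc : 'I_(size fs).+1) (K : {set 'I_n}), #|K| = k ->
    mincut_ge (@ifg_edge R n s fs tc K alpha beta)
      (None : node (size fs) n) (Some None) M.

Definition is_alpha_star (R : numFieldType) (n k s : nat) (M gamma a : R)
  : Prop :=
  let beta := gamma / (n %/ s)%:R in
  fcrs_feasible n k s M a beta /\
  (forall a' : R, fcrs_feasible n k s M a' beta -> a <= a').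

Definition fbound (R : numFieldType) (n k s : nat) (M : R) (i : nat) : R :=
  let d := (n %/ s)%N in
  if (i < k./2)%N then
    M * d%:R / ((2 * k - i - 1) * i + k * (d - k + 1))%:R
  else
    M * d%:R / (k * d - k./2 * uphalf k)%:R.

(* Main.v *)
Require Import Defs.
From mathcomp Require Import all_boot all_order all_algebra.
From mathcomp Require Import zify ring lra.
Set Implicit Arguments. Unset Strict Implicit. Unset Printing Implicit Defensive.
Import Order.TTheory GRing.Theory Num.Theory.
Local Open Scope ring_scope.

(** Follow the set [S] of servers whose out-node lies on the sink side of a
    finite cut. Over time [S] shrinks for free, a server enters at cost [alpha],
    and a server repaired from cluster [i] enters at cost [(d - c) beta], where
    [c] counts the servers of cluster [i] already in [S]. With [m = #|S|], [a] the
    largest number of servers of [S] in one cluster, and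
    [h x = max 0 (alpha - (d - x) beta)] the gain of a repair over a plain entry,
    the cost paid so far is at least [m alpha - (m - a) h a] until [m] reaches
    [k]: the convexity of [h] makes this potential compatible with all moves, and
    [k <= d] makes it monotone in [S]. At [m = k] it is a cut
    [(k - j) alpha + j (d - k + j) beta], which is attained when [j] servers of
    one cluster are repaired from another one holding [k - j] servers of the
    collector. Hence [alpha] is feasible iff all these cuts are at least [M], and
    [fbound] lists the values of [gamma] where the binding [j] changes. *)

(** * The potential as a function of two numbers *)

Section Potential.

Variables (R : realFieldType) (d : nat) (alpha beta : R).
Hypotheses (alpha_ge0 : 0 <= alpha) (beta_ge0 : 0 <= beta).
Hypothesis alpha_le : alpha <= d%:R * beta.

Definition saving (x : nat) : R := Num.max 0 (alpha - (d%:R - x%:R) * beta).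

Definition potential (m a : nat) : R := m%:R * alpha - (m%:R - a%:R) * saving a.

Variant saving_spec (x : nat) : R -> Prop :=
| SavingZero of alpha - (d%:R - x%:R) * beta <= 0 : saving_spec x 0
| SavingPos of 0 <= alpha - (d%:R - x%:R) * beta :
    saving_spec x (alpha - (d%:R - x%:R) * beta).

Lemma savingP (x : nat) : saving_spec x (saving x).
Proof.
by rewrite /saving; case: leP => H; constructor; rewrite // ltW.
Qed.

Lemma saving_ge0 (x : nat) : 0 <= saving x.
Proof. by case: savingP. Qed.

Lemma saving_homo (x y : nat) : (x <= y)%N -> saving x <= saving y.
Proof.
move=> xy; have : 0 <= (y%:R - x%:R) * beta :> R by rewrite mulr_ge0 // subr_ge0 ler_nat.
by case: savingP => Hx; case: savingP => Hy //; lra.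
Qed.

(** If the maximum does not grow, the change is [alpha - saving a], and [saving a <= alpha] since
    [a <= d]. If it grows, the change is [alpha] minus [m - a] times an increment of [saving]. An
    increment is at most [beta], and it is positive only if [alpha >= (d - a - 1) beta], which is at
    least [(m - a) beta] because [m < d]. *)
Lemma potential_mono (m a a' : nat) : (a <= m)%N -> (m < d)%N ->
  a' = a \/ a' = a.+1 -> potential m a <= potential m.+1 a'.
Proof.
have a0 := alpha_ge0; have b0 := beta_ge0.
move=> am md.
have {}am : 0 <= m%:R - a%:R :> R by rewrite subr_ge0 ler_nat.
have {md} : 0 <= (d%:R - m%:R - 1) * beta :> R.
  by rewrite mulr_ge0 // -addrA -opprD subr_ge0 natr1 ler_nat.
have mab : 0 <= (m%:R - a%:R) * beta by exact: mulr_ge0.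
rewrite /potential -natr1 => mdb [->|->].
  by case: (savingP a) => H; lra.
rewrite -natr1.
case: (savingP a) => H; case: (savingP a.+1); rewrite -natr1 => H'.
- lra.
- have : 0 <= (m%:R - a%:R) * ((d%:R - a%:R) * beta - alpha).
    by rewrite mulr_ge0 //; lra.
  lra.
- have : 0 <= (m%:R - a%:R) * (alpha - (d%:R - a%:R) * beta) by rewrite mulr_ge0.
  lra.
- lra.
Qed.

Lemma potential_store (m a a' : nat) : (a <= m)%N ->
  a' = a \/ a' = a.+1 -> potential m.+1 a' <= potential m a + alpha.
Proof.
move=> am; have {}am : 0 <= m%:R - a%:R :> R by rewrite subr_ge0 ler_nat.
rewrite /potential -natr1 => -[->|->].
  have := saving_ge0 a; lra.
have /saving_homo := leqnSn a; rewrite -subr_ge0 => /(mulr_ge0 am).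
rewrite -[a.+1%:R]natr1; lra.
Qed.

(* [saving] is convex and vanishes at [0], so its increment at [a >= c] is at
   least [saving c / c]; this pays for enlarging the largest cluster. *)
Lemma potential_repair (m a a' c : nat) : (a <= m)%N -> (c <= a)%N ->
  a' = a \/ a' = a.+1 /\ (c + a <= m)%N ->
  potential m.+1 a' <= potential m a + (d%:R - c%:R) * beta.
Proof.
have a0 := alpha_ge0; have b0 := beta_ge0; have ab := alpha_le.
move=> am ca; have {}am : a%:R <= m%:R :> R by rewrite ler_nat.
have hca := saving_homo ca; have hc : c%:R <= a%:R :> R by rewrite ler_nat.
have hc0 : alpha - (d%:R - c%:R) * beta <= saving c.
  by case: savingP => // _.
rewrite /potential -natr1 => -[->|[-> cam]]; first by lra.
have {}cam : 0 <= (m%:R - a%:R - c%:R) * beta :> R.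
  by rewrite mulr_ge0 // -addrA -opprD subr_ge0 -natrD ler_nat addnC.
have /saving_homo := leqnSn a; rewrite -subr_ge0 => hS.
have := mulr_ge0 (_ : 0 <= m%:R - a%:R) hS; rewrite subr_ge0 => /(_ am).
move: hca hc0; rewrite -natr1.
case: (savingP c) => H0; case: (savingP a.+1); rewrite -natr1 => H1;
  case: (savingP a) => H2; lra.
Qed.

(** * The potential of a set of servers *)

Variables (n s k : nat) (M : R).
Hypothesis kd : (k <= d)%N.
Hypothesis potential_final :
  forall a, (0 < a <= k)%N -> M <= potential k a.
Hypothesis k_gt0 : (0 < k)%N.

Definition in_cluster (S : {set 'I_n}) (j : nat) : nat :=
  #|[set u in S | cluster s u == j]|.

Definition max_cluster (S : {set 'I_n}) : nat :=
  \max_(v in S) in_cluster S (cluster s v).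

Implicit Types S P : {set 'I_n}.

Lemma in_cluster_le_max S j : (in_cluster S j <= max_cluster S)%N.
Proof.
case: (set_0Vmem [set u in S | cluster s u == j]) => [|[v]].
  by rewrite /in_cluster => ->; rewrite cards0.
rewrite inE => /andP[vS /eqP <-].
by rewrite /max_cluster (bigD1 v) //= leq_maxl.
Qed.

Lemma max_cluster_le_card S : (max_cluster S <= #|S|)%N.
Proof.
apply/bigmax_leqP => v _; apply/subset_leq_card/subsetP => u.
by rewrite inE => /andP[].
Qed.

Lemma max_cluster_gt0 S : (0 < #|S|)%N -> (0 < max_cluster S)%N.
Proof.
case/card_gt0P => v vS; apply: leq_trans (in_cluster_le_max S (cluster s v)).
by apply/card_gt0P; exists v; rewrite inE vS eqxx.
Qed.

Lemma in_cluster_add S i j :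
  i != j -> (in_cluster S i + in_cluster S j <= #|S|)%N.
Proof.
move=> ij; rewrite /in_cluster -cardsUI.
have -> : [set u in S | cluster s u == i] :&: [set u in S | cluster s u == j] = set0.
  apply/setP => u; rewrite !inE; case: eqP => [->|]; last by rewrite andbF.
  by rewrite (negPf ij) !andbF.
rewrite cards0 addn0; apply/subset_leq_card/subsetP => u.
by rewrite !inE => /orP[] /andP[].
Qed.

Lemma in_clusterU1 S v j : v \notin S ->
  in_cluster (v |: S) j = ((cluster s v == j) + in_cluster S j)%N.
Proof.
move=> vS; rewrite /in_cluster.
case: (boolP (cluster s v == j)) => vj; last first.
  congr #|pred_of_set _|; apply/setP => u; rewrite !inE.
  by case: (eqVneq u v) => //= ->; rewrite (negPf vj) andbF.
rewrite -[RHS](_ : #|v |: [set u in S | cluster s u == j]| = _); last first.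
  by rewrite cardsU1 inE (negPf vS).
congr #|pred_of_set _|; apply/setP => u; rewrite !inE.
by case: (eqVneq u v) => //= ->; rewrite vj.
Qed.

Lemma max_clusterU1 S v : v \notin S ->
  max_cluster (v |: S) = maxn (max_cluster S) (in_cluster S (cluster s v)).+1.
Proof.
move=> vS; apply/eqP; rewrite eqn_leq; apply/andP; split.
  apply/bigmax_leqP => u _; rewrite in_clusterU1 //.
  case: eqP => [<-|_]; first by rewrite add1n leq_maxr.
  by rewrite add0n leq_max in_cluster_le_max.
rewrite geq_max; apply/andP; split.
  apply/bigmax_leqP => u uS; apply: leq_trans (in_cluster_le_max _ (cluster s u)).
  by rewrite in_clusterU1 // leq_addl.
apply: leq_trans (in_cluster_le_max _ (cluster s v)).
by rewrite in_clusterU1 // eqxx add1n.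
Qed.

Definition set_potential (S : {set 'I_n}) : R := potential #|S| (max_cluster S).

(* Once [S] has had [k] elements the cost is at least [M], and [S] is no longer
   tracked: the potential is monotone only up to size [d]. *)
Definition pays_for (C : R) (S : {set 'I_n}) : Prop :=
  M <= C \/ (#|S| < k)%N /\ set_potential S <= C.

Lemma max_clusterU1_cases S v : v \notin S ->
  max_cluster (v |: S) = max_cluster S \/
  max_cluster (v |: S) = (max_cluster S).+1.
Proof.
move=> vS; rewrite max_clusterU1 //.
have := in_cluster_le_max S (cluster s v); lia.
Qed.

Lemma pays_for_potential C S : (#|S| <= k)%N -> set_potential S <= C ->
  pays_for C S.
Proof.
rewrite leq_eqVlt => /orP[/eqP Sk|Sk] SC; last by right.
left; apply: le_trans SC; rewrite /set_potential Sk; apply: potential_final.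
by rewrite max_cluster_gt0 ?Sk // -Sk max_cluster_le_card.
Qed.

Lemma pays_for_leC C C' S : C <= C' -> pays_for C S -> pays_for C' S.
Proof.
move=> CC' [MC|[Sk SC]]; first by left; apply: le_trans CC'.
by right; split; rewrite // (le_trans SC).
Qed.

Lemma pays_forD1 C S v : pays_for C (v |: S) -> pays_for C S.
Proof.
have [vS|vS] := boolP (v \in S); first by rewrite setUC (setUidPl _) ?sub1set.
case=> [MC|[]]; [by left|rewrite cardsU1 vS add1n => Sk SC; right].
split; first exact: ltnW; apply: le_trans SC.
rewrite /set_potential cardsU1 vS add1n.
apply: potential_mono; first exact: max_cluster_le_card.
  by apply: leq_trans kd; apply: ltnW.
exact: max_clusterU1_cases.
Qed.

Lemma pays_for_subset C S S' : S' \subset S -> pays_for C S -> pays_for C S'.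
Proof.
(* With [S] written as [S' :|: S], the servers of the right-hand copy are removed one at a time. *)
move=> /setUidPr <-; rewrite -[S in _ :|: S]set_enum.
elim: (enum S) => [|v l IH]; first by rewrite set_nil setU0.
by rewrite set_cons setUCA => /pays_forD1.
Qed.

Lemma pays_for_store C S v : pays_for C S -> pays_for (C + alpha) (v |: S).
Proof.
move=> H; have [vS|vS] := boolP (v \in S).
  rewrite setUC (setUidPl _) ?sub1set //; apply: pays_for_leC H.
  by rewrite lerDl.
case: H => [MC|[Sk SC]]; first by left; apply: le_trans MC _; rewrite lerDl.
apply: pays_for_potential; rewrite /set_potential ?cardsU1 vS ?add1n //.
apply: le_trans (_ : set_potential S + alpha <= _); last by rewrite lerD2r.
apply: potential_store; first exact: max_cluster_le_card.
exact: max_clusterU1_cases.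
Qed.

Lemma pays_for_store_set C S P :
  pays_for C S -> pays_for (C + #|P|%:R * alpha) (P :|: S).
Proof.
rewrite cardE -[X in X :|: S]set_enum => H.
elim: (enum P) => [|v l IH]; first by rewrite set_nil set0U mul0r addr0.
rewrite set_cons -setUA /= -natr1 mulrDl mul1r addrA.
exact: pays_for_store.
Qed.

Lemma pays_for_repair C S v i : i != cluster s v -> pays_for C S ->
  pays_for (C + (d - in_cluster S i)%:R * beta) (v |: S).
Proof.
move=> iv H; have [vS|vS] := boolP (v \in S).
  rewrite setUC (setUidPl _) ?sub1set //; apply: pays_for_leC H.
  by rewrite lerDl mulr_ge0.
case: H => [MC|[Sk SC]].
  by left; apply: le_trans MC _; rewrite lerDl mulr_ge0.
apply: pays_for_potential; rewrite /set_potential ?cardsU1 vS ?add1n //.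
set c := in_cluster S i.
have cm : (c <= max_cluster S)%N := in_cluster_le_max S i.
have mS := max_cluster_le_card S.
apply: le_trans (_ : set_potential S + (d - c)%:R * beta <= _); last by rewrite lerD2r.
rewrite natrB; last by lia.
apply: potential_repair => //.
(* If the maximum grows, the cluster of [v] already attained it. That cluster is disjoint from the
   repair cluster, so [c] plus the maximum is at most [#|S|]. *)
have := in_cluster_add S iv; have := in_cluster_le_max S (cluster s v).
rewrite max_clusterU1 // -/c; lia.
Qed.

End Potential.

(** * Cluster sizes, and cuts grouped by head node *)

Lemma cluster_eqE (n s : nat) (u : 'I_n) (i : nat) : (i < s)%N -> (0 < n %/ s)%N ->
  (cluster s u == i) = (i * (n %/ s) <= u < i.+1 * (n %/ s))%N.
Proof.
move=> si d0; rewrite /cluster /=; set d := (n %/ s)%N in d0 *.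
case: ifPn => uds; first by rewrite eqn_leq -ltnS ltn_divLR // leq_divRL // andbC.
rewrite gtn_eqF //; apply/esym/negP => /andP[_ h]; case/negP: uds.
by apply: leq_trans h _; rewrite mulnC leq_mul2l si orbT.
Qed.

Lemma card_ord_interval (n p q : nat) : (p + q <= n)%N ->
  #|[set u : 'I_n | (p <= u < p + q)%N]| = q.
Proof.
move=> pqn; have ltn (x : 'I_q) : (p + x < n)%N by have := ltn_ord x; lia.
have -> : [set u : 'I_n | (p <= u < p + q)%N] = [set Ordinal (ltn x) | x : 'I_q].
  apply/setP => u; rewrite inE; apply/andP/imsetP.
    move=> [lo hi]; have ux : (u - p < q)%N by lia.
    by exists (Ordinal ux) => //; apply: val_inj => /=; lia.
  by case=> x _ ->; have := ltn_ord x; rewrite /=; lia.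
rewrite card_imset ?card_ord // => x y [] /addnI; exact: val_inj.
Qed.

Lemma card_cluster (n s i : nat) : (i < s)%N -> (0 < n %/ s)%N ->
  #|[set u : 'I_n | cluster s u == i]| = (n %/ s)%N.
Proof.
move=> si d0; have d_in : (i * (n %/ s) + n %/ s <= n)%N.
  rewrite addnC -mulSn; apply: leq_trans (leq_divM n s).
  by rewrite [leqRHS]mulnC leq_mul2r si orbT.
rewrite -[RHS](card_ord_interval d_in); congr #|pred_of_set _|.
by apply/setP => u; rewrite !inE cluster_eqE // mulSn [(n %/ s + _)%N]addnC.
Qed.

(** Grouping the crossing edges by their heads splits a cut into one cost per time slot. Heads equal
    to the source or the collector are dropped. *)
Lemma cut_value_ge_nodes (R : numDomainType) (T n : nat)
  (E : node T n -> node T n -> option (cap R)) (U : {set node T n}) :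
  (forall x y, 0 <= fincap (E x y)) ->
  \sum_(t : 'I_T.+1) \sum_(v : 'I_n) \sum_(b : bool)
    (if Some (Some (t, v, b)) \in U then 0
     else \sum_(x in U) fincap (E x (Some (Some (t, v, b))))) <= cut_value E U.
Proof.
move=> E0; rewrite pair_bigA /= pair_bigA /= /cut_value exchange_big /=.
rewrite [leRHS]big_mkcond /= [leRHS](bigID (fun y : node T n =>
  if y is Some (Some _) then true else false)) /=.
apply: ler_wpDr.
  by apply: sumr_ge0 => y _; case: ifP => // _; apply: sumr_ge0.
rewrite (reindex_omap (fun p => Some (Some p))
  (fun y : node T n => if y is Some y' then y' else None)); last first.
  by case=> [[p|]|].
rewrite le_eqVlt; apply/orP; left; apply/eqP.
apply: eq_big => [[[t v] b]|[[t v] b] _]; first by rewrite /= eqxx.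
by rewrite inE; case: ifP.
Qed.

Lemma fincap_ifg_ge0 (R : numDomainType) (n s : nat) (fs : seq ('I_n * 'I_s)) tc K
  (alpha beta : R) x y : 0 <= alpha -> 0 <= beta ->
  0 <= fincap (@ifg_edge R n s fs tc K alpha beta x y).
Proof.
move=> a0 b0; case: x y => [[[[t v] []]|]|] [[[[t' v'] []]|]|] //=; try by case: ifP.
by case: ifP => // _; case: (onth _ _) => [[r i]|] //; case: ifP => _; case: ifP.
Qed.

(** * Lower bound on every finite cut *)

Section CutBound.

Variables (R : realFieldType) (n s k : nat) (M alpha beta : R).
Local Notation d := (n %/ s)%N.
Hypotheses (alpha_ge0 : 0 <= alpha) (beta_ge0 : 0 <= beta).
Hypothesis alpha_le : alpha <= d%:R * beta.
Hypotheses (kd : (k <= d)%N) (k_gt0 : (0 < k)%N).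
Hypothesis potential_final :
  forall a, (0 < a <= k)%N -> M <= potential d alpha beta k a.

Variables (fs : seq ('I_n * 'I_s)) (tc : 'I_(size fs).+1) (K : {set 'I_n}).
Hypothesis fs_valid : valid_failures fs.
Local Notation E := (@ifg_edge R n s fs tc K alpha beta).
Variable U : {set node (size fs) n}.
Hypotheses (srcU : None \in U) (snkU : Some None \notin U).
Hypothesis finU : ~~ cut_has_inf E U.

Local Notation T := (size fs).
Local Notation inU t v := (Some (Some (t, v, false)) \in U).
Local Notation outU t v := (Some (Some (t, v, true)) \in U).

Lemma finite_cut x y : is_inf (E x y) -> x \in U -> y \in U.
Proof.
move=> Exy xU; apply: contraNT finU => yU.
by apply/existsP; exists x; rewrite xU; apply/existsP; exists y; rewrite inE yU.
Qed.

Definition sink_servers (t : 'I_T.+1) : {set 'I_n} := [set v | ~~ outU t v].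
(** The storage edge of such a server crosses the cut. *)
Definition paying_servers (t : 'I_T.+1) : {set 'I_n} :=
  [set v | ~~ outU t v & inU t v].
Definition slot_cost (t : 'I_T.+1) : R :=
  \sum_(v : 'I_n) \sum_(b : bool)
    (if Some (Some (t, v, b)) \in U then 0
     else \sum_(x in U) fincap (E x (Some (Some (t, v, b))))).

Lemma inflow_ge0 y : 0 <= \sum_(x in U) fincap (E x y).
Proof. by apply: sumr_ge0 => x _; apply: fincap_ifg_ge0. Qed.

Lemma slot_cost_ge0 t : 0 <= slot_cost t.
Proof.
apply: sumr_ge0 => v _; apply: sumr_ge0 => b _; case: ifP => // _.
exact: inflow_ge0.
Qed.

(** Out-nodes as heads give the first term, in-nodes the second. The second is left unevaluated: it
    is discarded except for the in-node of a repaired server. *)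
Lemma slot_cost_store t :
  #|paying_servers t|%:R * alpha +
  \sum_(v : 'I_n | ~~ inU t v) \sum_(x in U) fincap (E x (Some (Some (t, v, false))))
  <= slot_cost t.
Proof.
rewrite /slot_cost; under [leRHS]eq_bigr => v _ do rewrite big_bool /=.
rewrite big_split /= lerD //; last first.
  by rewrite big_mkcond /=; apply: ler_sum => v _; rewrite if_neg.
rewrite mulr_natl -sumr_const big_mkcond /=; apply: ler_sum => v _.
rewrite inE; case: ifP => [/andP[/negPf -> vU]|_]; last first.
  by case: ifP => // _; apply: inflow_ge0.
rewrite (bigD1 _ vU) /= !eqxx /=.
by rewrite lerDl; apply: sumr_ge0 => x _; apply: fincap_ifg_ge0.
Qed.

Lemma sink_servers0 : sink_servers ord0 \subset paying_servers ord0.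
Proof.
apply/subsetP => v; rewrite !inE => ->.
by apply: (@finite_cut None).
Qed.

(** Infinite edges join consecutive copies of every server other than the failed one. So a server of
    [sink_servers t'] pays for storage, or was in [sink_servers t], or is the failed server, whose
    repair edges are then charged. *)
Lemma repair_step (t t' : 'I_T.+1) C : t' = t.+1 :> nat ->
  pays_for d alpha beta s k M C (sink_servers t) ->
  pays_for d alpha beta s k M (C + slot_cost t') (sink_servers t').
Proof.
move=> tt' H; have tT : (t < T)%N by rewrite -ltnS -tt'.
have [[r i] fsti] : exists p, onth fs t = Some p.
  by move: tT; rewrite -onthTE; case: (onth fs t) => // p _; exists p.
have ri : nat_of_ord i != cluster s r.
  move/allP: fs_valid => /(_ (r, i)) /=; rewrite eq_sym; apply.
  by apply/onthP; exists t.
have keep v : v != r -> ~~ inU t' v -> v \in sink_servers t.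
  move=> vr; rewrite inE; apply: contra; apply: finite_cut.
  by rewrite /= tt' eqxx fsti (negPf vr) eqxx.
have sub v : v \in sink_servers t' -> (v \in paying_servers t') || ~~ inU t' v.
  by rewrite !inE => ->; case: (inU t' v).
set P := paying_servers t'.
have [rU|rU] := boolP (inU t' r).
  apply: pays_for_subset (_ : _ \subset P :|: sink_servers t) _ => //.
    apply/subsetP => v /sub; rewrite in_setU => /orP[->//|vin].
    by rewrite (keep v) ?orbT //; apply: contraNneq vin => ->.
  apply: pays_for_leC (_ : C + #|P|%:R * alpha <= _) _.
    rewrite lerD2l; apply: le_trans (slot_cost_store t'); rewrite lerDl.
    by apply: sumr_ge0 => v _; apply: inflow_ge0.
  exact: pays_for_store_set.
(* The repair is charged before the storage edges: helpers send from their out-nodes at time [t], so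
   [c] has to be counted in [sink_servers t]. *)
have {}H := pays_for_repair alpha_ge0 beta_ge0 alpha_le kd potential_final k_gt0 ri H.
apply: pays_for_subset (_ : _ \subset P :|: (r |: sink_servers t)) _ => //.
  apply/subsetP => v /sub; rewrite !in_setU => /orP[->//|vin].
  by rewrite in_set1; have [//|vr] := eqVneq v r; rewrite ?orbT // (keep v) ?orbT.
set c := in_cluster _ _ _ in H.
apply: pays_for_leC (_ : C + (d - c)%:R * beta + #|P|%:R * alpha <= _) _; last first.
  exact: pays_for_store_set.
rewrite -addrA lerD2l addrC; apply: le_trans (slot_cost_store t').
rewrite lerD2l (bigD1 r) //=; apply: ler_wpDr.
  by apply: sumr_ge0 => v _; apply: inflow_ge0.
(* Of the [d] helpers, the [c] on the sink side contribute nothing to the cut. *)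
have <- : #|[set u : 'I_n | cluster s u == i & outU t u]| = (d - c)%N.
  rewrite -(@card_cluster n s i) //; last exact: leq_trans kd.
  rewrite /c /in_cluster.
  rewrite -(cardsID [set u | outU t u] [set u | cluster s u == i]).
  rewrite (_ : #|_ :\: _| = #|[set u in sink_servers t | cluster s u == i]|).
    by rewrite addnK; congr #|pred_of_set _|; apply/setP => u; rewrite !inE.
  by congr #|pred_of_set _|; apply/setP => u; rewrite !inE.
rewrite mulr_natl -sumr_const [leRHS]big_mkcond /=.
rewrite [leRHS](bigID (fun y : node T n =>
  if y is Some (Some (t0, _, true)) then t0 == t else false)) /=.
apply: ler_wpDr.
  by apply: sumr_ge0 => y _; case: ifP => // _; apply: fincap_ifg_ge0.
rewrite (reindex_omap (fun u => Some (Some (t, u, true)))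
  (fun y : node T n => if y is Some (Some (_, u, _)) then Some u else None)); last first.
  by case=> [[[[t0 u] []]|]|] //= /eqP ->.
rewrite [leRHS](eq_bigl xpredT) => [|u]; last by rewrite /= !eqxx.
rewrite big_mkcond; apply: ler_sum => u _ /=.
rewrite inE tt' eqxx fsti eqxx.
by case: (cluster s u == i); case: (_ \in U).
Qed.

Lemma cut_value_ge : #|K| = k -> M <= cut_value E U.
Proof.
move=> Kk.
have inv j : (j <= T)%N ->
  pays_for d alpha beta s k M (\sum_(t < T.+1 | (t <= j)%N) slot_cost t)
    (sink_servers (inord j)).
  elim: j => [_|j IH jT].
    rewrite (_ : inord 0 = ord0); last by apply: val_inj; rewrite /= inordK.
    rewrite (big_pred1 ord0) => [|t]; last by rewrite leqn0.
    (* At time 0 the tracked set is built from the empty set through storage edges only. *)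
    have H0 : pays_for d alpha beta s k M 0 (set0 : {set 'I_n}).
      right; rewrite cards0; split=> //; rewrite /set_potential cards0.
      by rewrite /max_cluster big_set0 /potential mul0r subrr mul0r subrr.
    have := pays_for_store_set alpha_ge0 beta_ge0 alpha_le kd potential_final k_gt0
      (paying_servers ord0) H0.
    rewrite setU0 add0r => {}H0; apply: pays_for_subset sink_servers0 _ => //.
    apply: pays_for_leC H0; apply: le_trans (slot_cost_store _); rewrite lerDl.
    by apply: sumr_ge0 => v _; apply: inflow_ge0.
  rewrite (bigD1 (inord j.+1)) /= ?inordK // addrC.
  rewrite (eq_bigl (fun t : 'I_T.+1 => t <= j)%N) => [|t]; last first.
    by rewrite -val_eqE /= inordK //; lia.
  apply: repair_step (IH (ltnW jT)); rewrite !inordK //; exact: ltnW.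
have := inv tc; rewrite -ltnS ltn_ord inord_val => /(_ isT).
(* The infinite edges into the collector force [k] servers into the sink side at time [tc], which
   excludes the second alternative of [pays_for]. *)
have KS : K \subset sink_servers tc.
  apply/subsetP => v vK; rewrite inE; apply: contra snkU; apply: finite_cut.
  by rewrite /= eqxx vK.
case=> [MC|[Sk _]]; last by have := subset_leq_card KS; rewrite Kk leqNgt Sk.
apply: le_trans MC _; apply: le_trans (cut_value_ge_nodes _ _); last first.
  by move=> x y; apply: fincap_ifg_ge0.
rewrite [leRHS](bigID (fun t : 'I_T.+1 => t <= tc)%N) /= lerDl.
by apply: sumr_ge0 => t _; apply: slot_cost_ge0.
Qed.

End CutBound.

(** * Necessary conditions from an explicit failure sequence *)

(* The cut is attained when [i] servers of cluster 1 fail in turn, all repaired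
   from cluster 0, and the collector reads them and [k - i] servers of cluster 0. *)
Lemma feasible_cut_bound (R : realFieldType) (n k s i : nat) (M alpha beta : R) :
  (0 < k)%N -> (2 <= s)%N -> (k <= n %/ s)%N -> (i <= k)%N ->
  fcrs_feasible n k s M alpha beta ->
  M <= (k - i)%:R * alpha + (i * (n %/ s - (k - i)))%:R * beta.
Proof.
move=> k0 s2 kd ik feas; set d := (n %/ s)%N in kd *.
have d0 : (0 < d)%N by exact: leq_trans kd.
have dn : (2 * d <= n)%N.
  by apply: leq_trans (leq_divM n s); rewrite mulnC leq_mul2l s2 orbT.
have n0 : (0 < n)%N by lia.
have s0 : (0 < s)%N by exact: ltnW.
pose srv (x : nat) : 'I_n := insubd (Ordinal n0) x.
have srvE x : (x < n)%N -> nat_of_ord (srv x) = x.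
  by move=> xn; have := val_insubd (Ordinal n0) x; rewrite xn.
pose fs := mkseq (fun j => (srv (d + j)%N, Ordinal s0 : 'I_s)) i.
have sfs : size fs = i by rewrite size_mkseq.
have fs_valid : valid_failures fs.
  apply/allP => p /mapP[j]; rewrite mem_iota /= => ji -> /=.
  by rewrite cluster_eqE // -/d mul0n mul1n srvE //; lia.
have onth_fs t : (t < i)%N -> onth fs t = Some (srv (d + t)%N, Ordinal s0).
  by move=> ti; rewrite onthE (nth_map (srv 0, Ordinal s0)) ?sfs // nth_mkseq.
pose K := [set u : 'I_n | (0 <= u < 0 + (k - i))%N] :|: [set u : 'I_n | (d <= u < d + i)%N].
have KE u : (u \in K) = (u < k - i)%N || (d <= u < d + i)%N.
  by rewrite !inE.
have Kk : #|K| = k.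
  rewrite cardsU !card_ord_interval; try lia.
  rewrite (_ : _ :&: _ = set0) ?cards0; first by lia.
  by apply/setP => u; rewrite !inE; lia.
(* The [k - i] collector servers of cluster 0 are cut at their storage edges at time 0, hence the
   exception for in-nodes at [t = 0]. In cluster 1, exactly the servers repaired by time [t] are on
   the sink side. *)
pose sink (y : node (size fs) n) := match y with
  | None => false | Some None => true
  | Some (Some (t, u, b)) =>
      if (u < k - i)%N then b || (0 < t)%N else (d <= u < d + t)%N end.
pose U := [set y | ~~ sink y].
pose E := @ifg_edge R n s fs ord_max K alpha beta.
have := feas fs fs_valid ord_max K Kk U; rewrite -/E !inE /= => /(_ isT isT).
have -> : ~~ cut_has_inf E U.
  apply/existsP => -[x /andP[]]; rewrite inE => xU /existsP[y /andP[]].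
  rewrite !inE negbK => yU.
  case: x y xU yU => [[[[t u] []]|]|] [[[[t' v] []]|]|] //=.
  - move=> xU yU; case: ifP => // /eqP tt'.
    have ti : (t < i)%N by have := ltn_ord t'; lia.
    rewrite onth_fs //; case: eqP => [_|vr]; first by case: ifP.
    case: eqP => // uv; subst v.
    have {vr} : nat_of_ord u <> (d + t)%N.
      by move=> ut; apply: vr; apply: val_inj; rewrite /= srvE //; lia.
    by move: xU yU; case: ifP => /=; lia.
  - move=> xU _; case: ifP => // /andP[/eqP tE]; rewrite KE.
    have {tE} : nat_of_ord t = i by rewrite tE /= sfs.
    by move: xU; case: ifP; lia.
  - by move=> _ _; case: ifP.
  - by move=> _ yU; case: eqP => // t0; move: yU; case: ifP => /=; lia.
move=> /(_ isT); congr (M <= _); rewrite /cut_value.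
(* The finite crossing edges are the storage edges [P1] at time 0 and the repair edges [P2] whose
   helpers the collector does not read. *)
pose P1 (p : node (size fs) n * node (size fs) n) := match p with
  | (Some (Some (t, u, false)), Some (Some (t', u', true))) =>
    [&& t == ord0, t' == t, u' == u & (u < k - i)%N]
  | _ => false end.
pose P2 (p : node (size fs) n * node (size fs) n) := match p with
  | (Some (Some (t, u, true)), Some (Some (t', v, false))) =>
    [&& t' == t.+1 :> nat, v == srv (d + t)%N & (k - i <= u < d)%N]
  | _ => false end.
rewrite pair_big_dep /= big_mkcond /=.
transitivity (\sum_p ((if P1 p then alpha else 0) + (if P2 p then beta else 0))).
  apply: eq_bigr => -[x y] _; rewrite !inE negbK.
  case: x y => [[[[t u] []]|]|] [[[[t' v] []]|]|] /=; rewrite ?addr0 ?add0r ?if_same ?andbF //.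
  - case: (eqVneq (nat_of_ord t') t.+1) => tt' /=; last by rewrite if_same.
    have ti : (t < i)%N by have := ltn_ord t'; lia.
    rewrite onth_fs //; case: (eqVneq v (srv (d + t)%N)) => [->|_] /=; last first.
      by rewrite (fun_if (@fincap R)) /= !if_same.
    rewrite cluster_eqE // mul0n mul1n -/d /= srvE; last by lia.
    rewrite (fun_if (@fincap R)) /=.
    rewrite -if_and; congr (if _ then _ else _).
    by case: ifP; case: ifP; lia.
  - by rewrite (fun_if (@fincap R)) /= !if_same.
  - rewrite (fun_if (@fincap R)) /= -if_and; congr (if _ then _ else _).
    rewrite [v == u]eq_sym [t' == t]eq_sym.
    case: (eqVneq u v) => [<-|_]; last by rewrite !andbF.
    case: (eqVneq t t') => [<-|_]; last by rewrite !andbF.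
    by rewrite -(inj_eq val_inj) /=; case: ifP; lia.
  - by rewrite (fun_if (@fincap R)) /= !if_same.
rewrite big_split /= -!big_mkcond /=; congr (_ + _).
  rewrite (reindex_omap (fun u => (Some (Some (ord0, u, false)), Some (Some (ord0, u, true))))
    (fun p => if p.1 is Some (Some (_, u, _)) then Some u else None)); last first.
    case=> [[[[[t u] []]|]|] [[[[t' v] []]|]|]] //=.
    by case/and4P=> /eqP -> /eqP -> /eqP ->.
  rewrite (eq_bigl (mem [set u : 'I_n | (0 <= u < 0 + (k - i))%N])) => [|u].
    by rewrite sumr_const card_ord_interval ?mulr_natl //; lia.
  by rewrite /= !eqxx andbT inE.
rewrite (reindex_omap (fun q : 'I_(size fs).+1 * 'I_n => (Some (Some (q.1, q.2, true)),
    Some (Some (inord q.1.+1, srv (d + q.1)%N, false))))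
  (fun p => if p.1 is Some (Some (t, u, _)) then Some (t, u) else None)); last first.
  case=> [[[[[t u] []]|]|] [[[[t' v] []]|]|]] //=.
  case/and3P=> /eqP tt' /eqP -> _; congr (Some (_, Some (Some (_, _, _)))).
  by apply: val_inj; rewrite /= inordK // -tt'.
rewrite (eq_bigl (mem (setX [set t : 'I_(size fs).+1 | (0 <= t < 0 + i)%N]
  [set u : 'I_n | (k - i <= u < k - i + (d - (k - i)))%N]))) => [|[t u]].
  rewrite sumr_const cardsX !card_ord_interval ?mulr_natl //; lia.
rewrite /= !eqxx andbT !inE /= subnKC; last by lia.
case: (ltnP t i) => ti; first by rewrite inordK ?eqxx //; lia.
(* At the last time there is no next slot, so [inord t.+1] cannot have value [t.+1]. *)
have tE : nat_of_ord t = size fs by have := ltn_ord t; lia.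
have := ltn_ord (inord t.+1 : 'I_(size fs).+1).
by case: eqP => // ->; rewrite tE; lia.
Qed.

(** * The binding cut and the thresholds for the bandwidth *)

Definition two_cluster_cut (R : realFieldType) (d k : nat) (alpha beta : R) (j : nat) : R :=
  (k%:R - j%:R) * alpha + j%:R * (d%:R - k%:R + j%:R) * beta.

(* With [alpha <= d * beta], the cut for [j > k / 2] dominates that for [k - j]. *)
Lemma two_cluster_cut_le_potential (R : realFieldType) (d k : nat) (M alpha beta : R) :
  alpha <= d%:R * beta ->
  (forall j, (j <= k./2)%N -> M <= two_cluster_cut d k alpha beta j) ->
  forall a, (0 < a <= k)%N -> M <= potential d alpha beta k a.
Proof.
move=> ab cutM a /andP[a0 ak]; rewrite /potential; case: savingP => _.
  by have := cutM 0%N isT; rewrite /two_cluster_cut; lra.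
(* When [saving a] is positive, the potential is the cut for [j = k - a]. *)
have [kak|kak] := leqP (k - a) k./2.
  by have := cutM _ kak; rewrite /two_cluster_cut natrB //; lra.
have ak2 : (a <= k./2)%N by lia.
have := cutM _ ak2; rewrite /two_cluster_cut.
have : 0 <= (k%:R - 2 * a%:R) * (d%:R * beta - alpha) :> R.
  by rewrite mulr_ge0 ?subr_ge0 // -natrM ler_nat; lia.
lra.
Qed.

Lemma feasible_of_cuts (R : realFieldType) (n k s : nat) (M alpha beta : R) :
  (0 < k)%N -> (k <= n %/ s)%N -> 0 <= alpha -> 0 <= beta ->
  alpha <= (n %/ s)%:R * beta ->
  (forall j, (j <= k./2)%N -> M <= two_cluster_cut (n %/ s) k alpha beta j) ->
  fcrs_feasible n k s M alpha beta.
Proof.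
move=> k0 kd a0 b0 ab cutM fs fs_valid tc K Kk U srcU snkU finU.
apply: cut_value_ge finU Kk => //; exact: two_cluster_cut_le_potential.
Qed.

(** At [beta = M / fbound_den d k j] and [alpha = (d - k + 2 j + 1) beta], the cuts for [j] and
    [j + 1] both equal [M]. *)
Definition fbound_den (d k j : nat) : nat := ((2 * k - j - 1) * j + k * (d - k + 1))%N.

Lemma fbound_denE (R : realFieldType) (d k j : nat) : (j < k)%N -> (k <= d)%N ->
  (fbound_den d k j)%:R =
  (2 * k%:R - j%:R - 1) * j%:R + k%:R * (d%:R - k%:R + 1) :> R.
Proof.
move=> jk kd; rewrite /fbound_den -subnDA natrD !natrM natrD natrB; last by lia.
by rewrite natrB // natrM natrD; ring.
Qed.

(* [two_cluster_cut] is convex in [j] with increments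
   [(d - k + 2 j + 1) beta - alpha], so the two conditions on [fbound_den] say that it
   is minimal at [j = i]. *)
Lemma alpha_star_at (R : realFieldType) (n k s i : nat) (M gamma a : R) :
  let d := (n %/ s)%N in let beta := gamma / d%:R in
  (0 < k)%N -> (2 <= s)%N -> (k <= d)%N -> 0 < M -> (i <= k./2)%N ->
  M <= (k * d - k./2 * uphalf k)%:R * beta ->
  ((i < k./2)%N -> M <= (fbound_den d k i)%:R * beta) ->
  ((0 < i)%N -> (fbound_den d k i.-1)%:R * beta <= M) ->
  two_cluster_cut d k a beta i = M ->
  is_alpha_star n k s M gamma a.
Proof.
move=> d beta k0 s2 kd M0 ik2.
have iu : (i <= uphalf k)%N by rewrite uphalf_half (leq_trans ik2) ?leq_addl.
have ik : (i < k)%N by lia.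
have hu_le : (k./2 * uphalf k <= k * d)%N by apply: leq_mul; lia.
move=> Mmax Mup Mlow aM.
have b0 : 0 <= beta.
  rewrite leNgt; apply/negP => b0; move: (lt_le_trans M0 Mmax).
  by rewrite ltNge nmulr_lle0 // ler0n.
have ki : 0 < k%:R - i%:R :> R by rewrite subr_gt0 ltr_nat.
have kd0 : 0 <= d%:R - k%:R :> R by rewrite subr_ge0 ler_nat.
have aup : (i < k./2)%N -> a <= (d%:R - k%:R + 2 * i%:R + 1) * beta.
  move=> {}ik2; rewrite -(ler_pM2l ki); have := Mup ik2.
  rewrite -aM /two_cluster_cut fbound_denE //.
  lra.
have alow : (0 < i)%N -> (d%:R - k%:R + 2 * i%:R - 1) * beta <= a.
  move=> i0; rewrite -(ler_pM2l ki); have := Mlow i0.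
  rewrite -aM /two_cluster_cut fbound_denE ?(leq_ltn_trans (leq_pred i)) //.
  by rewrite -(prednK i0) -natr1; lra.
have cutM j : (j <= k./2)%N -> M <= two_cluster_cut d k a beta j.
  move=> jk2; rewrite -aM -subr_ge0.
  have -> : two_cluster_cut d k a beta j - two_cluster_cut d k a beta i
    = (j%:R - i%:R) * ((d%:R - k%:R + i%:R + j%:R) * beta - a).
    by rewrite /two_cluster_cut; ring.
  have [ij|ji|->] := ltngtP i j; last by rewrite subrr mul0r.
    rewrite mulr_ge0 ?subr_ge0 ?ler_nat 1?ltnW //.
    apply: le_trans (aup _) _; first exact: leq_trans jk2.
    by rewrite ler_wpM2r //; have : i%:R + 1 <= j%:R :> R; [rewrite natr1 ler_nat|lra].
  rewrite -mulrNN mulr_ge0 // oppr_ge0 subr_le0 ?ler_nat 1?ltnW //.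
  apply: le_trans (alow _); last exact: leq_ltn_trans ji.
  by rewrite ler_wpM2r //; have : j%:R + 1 <= i%:R :> R; [rewrite natr1 ler_nat|lra].
have a0 : 0 <= a.
  have := cutM 0%N isT; rewrite /two_cluster_cut subr0 !mul0r addr0 => /(lt_le_trans M0).
  by rewrite pmulr_rgt0 ?ltr0n // => /ltW.
(* At storage [d * beta] the cut for [i] is [(k d - i (k - i)) beta]. Since
   [i (k - i) <= k./2 * uphalf k], this is at least [M] by [Mmax]. *)
have ab : a <= d%:R * beta.
  have : i%:R * (k%:R - i%:R) <= (k./2)%:R * (uphalf k)%:R :> R.
    have -> : k%:R = (k./2)%:R + (uphalf k)%:R :> R.
      by rewrite -natrD uphalf_half addnCA addnn odd_double_half.
    have : 0 <= ((k./2)%:R - i%:R) * ((uphalf k)%:R - i%:R) :> R.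
      by rewrite mulr_ge0 // subr_ge0 ler_nat.
    lra.
  rewrite -subr_ge0 => /mulr_ge0 /(_ b0) iuh.
  rewrite -(ler_pM2l ki); move: Mmax; rewrite natrB //.
  rewrite !natrM -aM /two_cluster_cut; lra.
split; first exact: feasible_of_cuts.
(* The cut for [i] alone bounds every feasible [a'] from below, whatever its sign. *)
move=> a' /(feasible_cut_bound k0 s2 kd (ltnW ik)); rewrite -/d -/beta => cut_a'.
rewrite -(ler_pM2l ki); move: cut_a'; rewrite -aM /two_cluster_cut natrM !natrB ?(ltnW ik) //.
  lra.
by rewrite (leq_trans (leq_subr i k)).
Qed.

Lemma bound_leE (R : realFieldType) (d N : nat) (M gamma : R) :
  (0 < d)%N -> (0 < N)%N ->
  (M * d%:R / N%:R <= gamma) = (M <= N%:R * (gamma / d%:R)).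
Proof.
move=> d0 N0; rewrite ler_pdivrMr ?ltr0n // mulrA ler_pdivlMr ?ltr0n //.
by rewrite [gamma * _]mulrC.
Qed.

Theorem theorem1 (R : realFieldType) (n k s : nat) (M gamma : R) :
  (0 < n)%N -> (0 < k)%N -> (2 <= s)%N -> (s <= n %/ k)%N ->
  0 < M ->
  fbound n k s M k./2 <= gamma ->
  (fbound n k s M 0 <= gamma -> is_alpha_star n k s M gamma (M / k%:R)) /\
  (forall i : nat, (1 <= i <= k./2)%N ->
     fbound n k s M i <= gamma < fbound n k s M i.-1 ->
     is_alpha_star n k s M gamma
       ((M - i%:R / (n %/ s)%:R * ((n %/ s) - k + i)%:R * gamma)
          / (k - i)%:R)).
Proof.
move=> n0 k0 s2 snk M0; set d := (n %/ s)%N.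
have kd : (k <= d)%N.
  by rewrite leq_divRL ?(ltnW s2) // mulnC -leq_divRL.
have d0 : (0 < d)%N by exact: leq_trans kd.
have den_gt0 j : (0 < fbound_den d k j)%N by rewrite /fbound_den; nia.
rewrite {1}/fbound ltnn /= -/d bound_leE //; last first.
  rewrite subn_gt0; apply: (@leq_ltn_trans (k./2 * d)); last by rewrite ltn_mul2r; lia.
  by apply: leq_mul; lia.
move=> Mmax.
have fbound_leE j : (j < k./2)%N ->
  (fbound n k s M j <= gamma) = (M <= (fbound_den d k j)%:R * (gamma / d%:R)).
  by move=> jk2; rewrite /fbound jk2 -/d -/(fbound_den d k j) bound_leE.
split=> [f0|i /andP[i0 ik2] /andP[fi fi1]].
  (* For [k = 1] the index 0 is already [k./2]; the upper condition is then vacuous and [Mmax] takes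
     its place. *)
  apply: (@alpha_star_at _ n k s 0) => //.
    by move=> k2; rewrite -fbound_leE.
  rewrite /two_cluster_cut subr0 !mul0r addr0 mulrC divfK //.
  by rewrite pnatr_eq0 -lt0n.
apply: (@alpha_star_at _ n k s i) => //.
- by move=> ik; rewrite -fbound_leE.
- by move=> _; move: fi1; rewrite ltNge fbound_leE ?prednK // -ltNge => /ltW.
rewrite /two_cluster_cut -/d natrD !natrB //; last by lia.
have d0' : d%:R != 0 :> R by rewrite pnatr_eq0 -lt0n.
have ki : k%:R - i%:R != 0 :> R.
  by rewrite subr_eq0 eqr_nat; apply/eqP; lia.
by field; rewrite ki d0'.
Qed.
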